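(* A topological Clifford semigroup $S$ is metrizable and zero-dimensional if one of the following conditions holds: (i) $S$ is Hausdorff, ditopological, $E(S)$ is a $U_2$-semilattice which embeds topologically into $\mathbb{N}^{\mathbb{N}}$ and each maximal subgroup of $S$ embeds topologically into $\mathbb{N}^{\mathbb{N}}$; (ii) $S$ is Hausdorff, ditopological, $E(S)$ is a $U$-semilattice which embeds topologically into $I_{\mathbb{N}}$ and each maximal subgroup of $S$ embeds topologically into $I_{\mathbb{N}}$.
   Context: An inverse semigroup is a semigroup $S$ such that for each $x\in S$ there is a unique $x^{-1}\in S$ with $xx^{-1}x=x$ and $x^{-1}xx^{-1}=x^{-1}$. It is Clifford if $xx^{-1}=x^{-1}x$ for all $x\in S$. A topological semigroup is a semigroup with a topology for which multiplication is continuous (such a topology is called a semigroup topology). A topological Clifford semigroup is a topological semigroup that is algebraically a Clifford semigroup. $E(S)=\{e\in S: e^2=e\}$ is a semilattice (commutative semigroup of idempotents). The maximal subgroups of $S$ are $H_e=\{x\in S: xx^{-1}=e=x^{-1}x\}$, $e\in E(S)$. $E(S)$ and the $H_e$ carry the subspace topology. A space is zero-dimensional if it has a basis of clopen sets. For a semilattice $X$, write $x\le y$ if $xy=x$, and ${\uparrow}x=\{y\in X: x\le y\}$. An ideal of $X$ is a subset $I$ with $ab\in I$ for all $a\in I$, $b\in X$. A semilattice $X$ with a topology is a $U$-semilattice if for every open set $U$ and every $x\in U$ there exist $y\in U$ and an open neighbourhood $V$ of $x$ such that $V\subseteq{\uparrow}y$; it is a $U_2$-semilattice if for every open set $U$ and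 every $x\in U$ there exist $y\in U$ and a clopen ideal $I\subseteq X$ such that $x\in X\setminus I\subseteq{\uparrow}y$. An inverse semigroup $S$ with a semigroup topology is called ditopological if inversion is continuous and for any point $x\in S$ and any neighbourhood $O$ of $x$ there are neighbourhoods $U$ and $W$ of $x$ and $xx^{-1}$, respectively, such that $$\{s\in S : \exists b\in U,\ \exists e\in W\cap E(S)\text{ such that } b=es\}\cap\{s\in S : ss^{-1}\in W\}\subseteq O.$$ $\mathbb{N}^{\mathbb{N}}$ is the monoid of all functions $\mathbb{N}\to\mathbb{N}$ under composition (functions act on the right and compose from left to right), with the product topology arising from the discrete topology on $\mathbb{N}$. $I_{\mathbb{N}}$ is the symmetric inverse monoid of all partial permutations of $\mathbb{N}$ (bijections between subsets of $\mathbb{N}$) under composition of binary relations, with the topology generated by the subbasis consisting of the sets $U_{x,y}=\{h : (x,y)\in h\}$, $W_x=\{h : x\notin\operatorname{dom}(h)\}$ and $W_x^{-1}=\{h : x\notin\operatorname{im}(h)\}$, for $x,y\in\mathbb{N}$. An embedding of semigroups is an injective homomorphism; an embedding $\phi:S\to T$ of topological semigroups is topological if both $\phi$ and $\phi^{-1}:(S)\phi\to S$ are continuous, where $(S)\phi$ has the subspace topology. ''$S$ embeds topologically into $T$'' means such a topological embedding exists. *)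

(* Defs.v *)
From HB Require Import structures.
From mathcomp Require Import all_boot all_order all_algebra finmap.
From mathcomp Require Import all_classical all_reals topology.

Set Implicit Arguments.
Unset Strict Implicit.
Unset Printing Implicit Defensive.

Local Open Scope classical_set_scope.
Local Open Scope group_scope.

HB.mixin Record Semigroup_isInverse S of Semigroup S := {
  sinv : S -> S;
  mulsVs : forall x : S, x * sinv x * x = x;
  mulVsV : forall x : S, sinv x * x * sinv x = sinv x;
  sinv_unique : forall x y : S, x * y * x = x -> y * x * y = y -> y = sinv x
}.

#[short(type="inverseSemigroupType")]
HB.structure Definition InverseSemigroup :=
  {S of Semigroup S & Semigroup_isInverse S}.

HB.mixin Record InverseSemigroup_isClifford S of InverseSemigroup S := {
  sinvC : forall x : S, x * sinv x = sinv x * x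
}.

#[short(type="cliffordSemigroupType")]
HB.structure Definition CliffordSemigroup :=
  {S of InverseSemigroup S & InverseSemigroup_isClifford S}.

HB.mixin Record Semigroup_isSemilattice X of Semigroup X := {
  mulsC : forall x y : X, x * y = y * x;
  mulss : forall x : X, x * x = x
}.

#[short(type="semilatticeType")]
HB.structure Definition Semilattice :=
  {X of Semigroup X & Semigroup_isSemilattice X}.

(* No compatibility is required between multiplication and topology. *)
#[short(type="semigroupTopologyType")]
HB.structure Definition SemigroupTopology :=
  {S of Topological S & Semigroup S}.

HB.mixin Record Topological_isTopSemigroup S of Topological S & Semigroup S := {
  muls_continuous : continuous (fun p : S * S => p.1 * p.2)
}.

#[short(type="topSemigroupType")]
HB.structure Definition TopSemigroup :=
  {S of Topological S & Semigroup S & Topological_isTopSemigroup S}.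

(* Continuity of [sinv] is not part of the following two structures. *)
#[short(type="inverseTopSemigroupType")]
HB.structure Definition InverseTopSemigroup :=
  {S of TopSemigroup S & InverseSemigroup S}.

#[short(type="cliffordTopSemigroupType")]
HB.structure Definition CliffordTopSemigroup :=
  {S of TopSemigroup S & CliffordSemigroup S}.

#[short(type="semilatticeTopologyType")]
HB.structure Definition SemilatticeTopology :=
  {X of Topological X & Semilattice X}.

Definition idempotents (S : semigroupType) : set S := [set e | e * e = e].
Arguments idempotents S : clear implicits.

Section InverseSemigroupTheory.
Variable S : inverseSemigroupType.
Implicit Types x y e f : S.

Lemma sinvK x : sinv (sinv x) = x.
Proof. by apply/esym/sinv_unique; rewrite ?mulsVs ?mulVsV. Qed.

Lemma sinv_idem e : e * e = e -> sinv e = e.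
Proof. by move=> ee; apply/esym/sinv_unique; rewrite !ee. Qed.

Let idem_sinvM e f : e * e = e -> f * f = f ->
  sinv (e * f) = e * f /\ (e * f) * (e * f) = e * f.
Proof.
move=> ee ff; pose x := sinv (e * f).
have xV : x * (e * f) * x = x by exact: mulVsV.
have xE : f * x * e = x.
  apply: sinv_unique.
  - rewrite -[RHS](mulsVs (e * f)) -/x !mulgA -(mulgA e f f) ff.
    by rewrite -(mulgA _ e e) ee.
  - by rewrite -[in RHS]xV !mulgA -(mulgA (f * x) e e) ee -(mulgA _ f f) ff.
have xx : x * x = x.
  by rewrite -{1}xE -{2}xE !mulgA -[in RHS]xE -[in RHS]xV !mulgA.
have efE : e * f = x by rewrite -[LHS]sinvK -/x sinv_idem.
by rewrite -/x efE.
Qed.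

Lemma idem_commute e f : e * e = e -> f * f = f -> e * f = f * e.
Proof.
move=> ee ff; have [efV efef] := idem_sinvM ee ff.
have [_ fefe] := idem_sinvM ff ee.
rewrite -[LHS]efV; apply/esym/sinv_unique.
- by rewrite !mulgA -(mulgA e f f) ff -(mulgA _ e e) ee -[RHS]efef mulgA.
- by rewrite !mulgA -(mulgA f e e) ee -(mulgA _ f f) ff -[RHS]fefe mulgA.
Qed.

Lemma idempotentsM e f :
  idempotents S e -> idempotents S f -> idempotents S (e * f).
Proof. by move=> ee ff; have [] := idem_sinvM ee ff. Qed.

Lemma idem_mulsV x : idempotents S (x * sinv x).
Proof. by rewrite /idempotents /= mulgA mulsVs. Qed.

Lemma idem_mulVs x : idempotents S (sinv x * x).
Proof. by rewrite /idempotents /= mulgA mulVsV. Qed.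

Lemma sinvM x y : sinv (x * y) = sinv y * sinv x.
Proof.
have C := idem_commute (idem_mulVs x) (idem_mulsV y).
apply/esym/sinv_unique.
- transitivity (x * ((y * sinv y) * (sinv x * x)) * y); first by rewrite !mulgA.
  by rewrite -C !mulgA mulsVs -!mulgA (mulgA y) mulsVs.
- transitivity (sinv y * ((sinv x * x) * (y * sinv y)) * sinv x).
    by rewrite !mulgA.
  by rewrite C !mulgA mulVsV -!mulgA (mulgA (sinv x)) mulVsV.
Qed.

Definition maximal_subgroup e : set S :=
  [set x | x * sinv x = e /\ sinv x * x = e].

Lemma maximal_subgroupM e x y : maximal_subgroup e x ->
  maximal_subgroup e y -> maximal_subgroup e (x * y).
Proof.
move=> [xV Vx] [yV Vy]; rewrite /maximal_subgroup /= sinvM; split.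
- by rewrite mulgA -(mulgA x) yV -Vx mulgA mulsVs Vx.
- by rewrite mulgA -(mulgA (sinv y)) Vx -yV mulgA mulVsV yV.
Qed.

End InverseSemigroupTheory.

(* The topology that the library puts on [set_type] is the subspace one. *)
Definition idempotent_semilattice (S : inverseSemigroupType) : Type :=
  set_type (idempotents S).

Definition maximal_subgroup_type (S : inverseSemigroupType) (e : S) : Type :=
  set_type (maximal_subgroup e).

Section SubsetMul.
Variables (S : semigroupType) (A : set S).
Hypothesis AM : forall x y, A x -> A y -> A (x * y).

Definition subset_mul (x y : set_type A) : set_type A :=
  SigSub (mem_set (AM (set_valP x) (set_valP y))).

Lemma subset_mulA : associative subset_mul.
Proof. by move=> x y z; apply/val_inj; rewrite /= mulgA. Qed.

End SubsetMul.

Lemma subset_mul_continuous (S : topSemigroupType) (A : set S)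
    (AM : forall x y, A x -> A y -> A (x * y)) :
  continuous (fun p : set_type A * set_type A => subset_mul AM p.1 p.2).
Proof.
apply/continuousP => _ [B oB <-].
pose h (p : set_type A * set_type A) : S := set_val p.1 * set_val p.2.
have hc : continuous h.
  move=> p; apply: (@continuous2_cvg _ _ _ _ _ _ _ _ (@monoid.mul S)).
  - exact: (@muls_continuous S (set_val p.1, set_val p.2)).
  - by apply: (cvg_comp _ _ cvg_fst); exact: initial_continuous.
  - by apply: (cvg_comp _ _ cvg_snd); exact: initial_continuous.
by move/continuousP: hc => /(_ B oB).
Qed.

HB.instance Definition _ (S : inverseSemigroupType) :=
  Choice.on (idempotent_semilattice S).
HB.instance Definition _ (S : inverseSemigroupType) :=
  isSemigroup.Build (idempotent_semilattice S)
    (subset_mulA (@idempotentsM S)).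

Section IdempotentSemilattice.
Variable S : inverseSemigroupType.
Local Notation E := (idempotent_semilattice S).

Let EC (x y : E) : x * y = y * x.
Proof.
apply/val_inj => /=.
by apply: idem_commute; [exact: (set_valP x) | exact: (set_valP y)].
Qed.

Let Ess (x : E) : x * x = x.
Proof. by apply/val_inj; exact: (set_valP x). Qed.

HB.instance Definition _ := Semigroup_isSemilattice.Build E EC Ess.

End IdempotentSemilattice.

HB.instance Definition _ (S : inverseTopSemigroupType) :=
  Topological.copy (idempotent_semilattice S) (set_type (idempotents S)).
HB.instance Definition _ (S : inverseTopSemigroupType) :=
  Topological_isTopSemigroup.Build (idempotent_semilattice S)
    (@subset_mul_continuous S _ (@idempotentsM S)).

HB.instance Definition _ (S : inverseSemigroupType) (e : S) :=
  Choice.on (maximal_subgroup_type e).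
HB.instance Definition _ (S : inverseSemigroupType) (e : S) :=
  isSemigroup.Build (maximal_subgroup_type e)
    (subset_mulA (@maximal_subgroupM S e)).
HB.instance Definition _ (S : inverseTopSemigroupType) (e : S) :=
  Topological.copy (maximal_subgroup_type e) (set_type (maximal_subgroup e)).
HB.instance Definition _ (S : inverseTopSemigroupType) (e : S) :=
  Topological_isTopSemigroup.Build (maximal_subgroup_type e)
    (@subset_mul_continuous S _ (@maximal_subgroupM S e)).

Definition upper (X : semilatticeType) (x : X) : set X := [set y | x * y = x].

(* The empty set is an ideal. *)
Definition ideal (X : semilatticeType) (I : set X) : Prop :=
  forall a b : X, I a -> I (a * b).

Definition U_semilattice (X : semilatticeTopologyType) : Prop :=
  forall (U : set X) (x : X), open U -> U x ->
  exists (y : X) (V : set X), [/\ U y, open V, V x & V `<=` upper y].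

Definition U2_semilattice (X : semilatticeTopologyType) : Prop :=
  forall (U : set X) (x : X), open U -> U x ->
  exists (y : X) (I : set X),
    [/\ U y, clopen I, ideal I, (~` I) x & ~` I `<=` upper y].

Definition ditopological (S : inverseTopSemigroupType) : Prop :=
  continuous (@sinv S) /\
  forall (x : S) (O : set S), nbhs x O ->
  exists U W : set S, [/\ nbhs x U, nbhs (x * sinv x) W &
    [set s | exists b e, [/\ U b, (W `&` idempotents S) e & b = e * s]]
      `&` [set s | W (s * sinv s)] `<=` O].

Definition NN : Type := {ptws nat -> nat}.

HB.instance Definition _ := Topological.copy NN {ptws nat -> nat}.

(* Functions act on the right: [f * g] is [f] followed by [g]. *)
Definition NN_mul (f g : NN) : NN := fun n => g (f n).

Lemma NN_mulA : associative NN_mul.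
Proof. by []. Qed.

HB.instance Definition _ := isSemigroup.Build NN NN_mulA.

Lemma NN_eval_near (f : NN) n : \forall h \near f, h n = f n.
Proof.
apply: (@proj_continuous nat (fun=> nat) n f [set f n]).
exact: discrete_set1.
Qed.

Lemma NN_mul_continuous : continuous (fun p : NN * NN => p.1 * p.2).
Proof.
move=> [f g]; apply/cvg_sup => n A /= [_ [[C oC <-] /= Cfg CA]].
exists ([set h : NN | h n = f n], [set h : NN | h (f n) = g (f n)]).
  by split; exact: NN_eval_near.
move=> [h k] /= [hn kn]; apply: CA => /=.
by rewrite /= /NN_mul [_ * _]/(NN_mul _ _) /NN_mul hn kn.
Qed.

HB.instance Definition _ := Topological_isTopSemigroup.Build NN NN_mul_continuous.

(* A partial permutation is represented by its graph. *)
Definition partial_permutation : set (set (nat * nat)) :=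
  [set h | (forall x y z, h (x, y) -> h (x, z) -> y = z) /\
           (forall x y z, h (x, z) -> h (y, z) -> x = y)].

Definition IN : Type := set_type partial_permutation.

Definition graph (h : IN) : set (nat * nat) := set_val h.

Lemma partial_permutation_comp (f g : set (nat * nat)) :
  partial_permutation f -> partial_permutation g ->
  partial_permutation [set p | exists2 y, f (p.1, y) & g (y, p.2)].
Proof.
move=> [f1 f2] [g1 g2]; split.
- move=> x y z [/= u fu gu] [/= v fv gv].
  by rewrite (f1 _ _ _ fu fv) in gu; exact: g1 gu gv.
- move=> x y z [/= u fu gu] [/= v fv gv].
  by rewrite (g2 _ _ _ gu gv) in fu; exact: f2 fu fv.
Qed.

(* [f * g] is [f] followed by [g]. *)
Definition IN_mul (f g : IN) : IN :=
  SigSub (mem_set (partial_permutation_comp (set_valP f) (set_valP g))).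

Lemma IN_mulA : associative IN_mul.
Proof.
move=> f g h; apply/val_inj; rewrite /= predeqE => -[x y]; split.
- by move=> [/= u fu [/= v gv hv]]; exists v => //; exists u.
- by move=> [/= v [/= u fu gv] hv]; exists u => //; exists v.
Qed.

HB.instance Definition _ := Choice.on IN.
HB.instance Definition _ := isSemigroup.Build IN IN_mulA.

Definition IN_subbasis : set (set IN) :=
  [set A | (exists x y, A = [set h | graph h (x, y)]) \/
           (exists x, A = [set h | ~ exists y, graph h (x, y)]) \/
           (exists x, A = [set h | ~ exists y, graph h (y, x)])].

HB.instance Definition _ := isSubBaseTopological.Build IN IN_subbasis id.

Lemma IN_subbasis_nbhs (A : set IN) h : IN_subbasis A -> A h -> nbhs h A.
Proof.
move=> sA Ah; apply: open_nbhs_nbhs; split=> //.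
exists [set A]; last by rewrite bigcup_set1.
move=> _ ->; exists [fset A]%fset; last by rewrite set_fset1 bigcap_set1.
by move=> B /fset1P ->; rewrite inE.
Qed.

Lemma IN_mul_continuous : continuous (fun p : IN * IN => p.1 * p.2).
Proof.
have pointE x y (h : IN) : graph h (x, y) ->
    nbhs h [set k : IN | graph k (x, y)].
  by move=> hxy; apply: IN_subbasis_nbhs => //; left; exists x, y.
have domE x (h : IN) : (~ exists y, graph h (x, y)) ->
    nbhs h [set k : IN | ~ exists y, graph k (x, y)].
  by move=> hx; apply: IN_subbasis_nbhs => //; right; left; exists x.
have imE x (h : IN) : (~ exists y, graph h (y, x)) ->
    nbhs h [set k : IN | ~ exists y, graph k (y, x)].
  by move=> hx; apply: IN_subbasis_nbhs => //; right; right; exists x.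
move=> [f g] A /= [_ [[B sB <-] [C BC Cfg]] CA].
apply: (@filterS _ _ _ C) => [p Cp|]; first by apply: CA; exists C.
have [D sD DC] := sB _ BC; move: Cfg; rewrite -DC => Dfg.
apply: filter_bigI => Q DQ; have := Dfg _ DQ; have := sD _ DQ; rewrite inE.
move=> [[x [y ->]]|[[x ->]|[x ->]]] /=.
- move=> [/= u fu gu].
  exists ([set k | graph k (x, u)], [set k | graph k (u, y)]) => /=.
    by split; exact: pointE.
  by move=> [h k] /= [hu ku]; exists u.
- move=> fgx; have [[u fu]|fx] := pselect (exists u, graph f (x, u)).
    exists ([set k | graph k (x, u)],
            [set k | ~ exists y, graph k (u, y)]) => /=.
      split; first exact: pointE.
      by apply: domE => -[y gy]; apply: fgx; exists y; exists u.
    move=> [h k] /= [hu ku] [y [/= v hv kv]]; apply: ku; exists y.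
    by have [h1 _] := set_valP h; rewrite (h1 _ _ _ hu hv).
  exists ([set k | ~ exists y, graph k (x, y)], setT) => /=.
    by split; [exact: domE|exact: filterT].
  by move=> [h k] /= [hx _] [y [/= v hv kv]]; apply: hx; exists v.
- move=> fgx; have [[u gu]|gx] := pselect (exists u, graph g (u, x)).
    exists ([set k | ~ exists y, graph k (y, u)],
            [set k | graph k (u, x)]) => /=.
      split; last exact: pointE.
      by apply: imE => -[y fy]; apply: fgx; exists y; exists u.
    move=> [h k] /= [hu ku] [y [/= v hv kv]]; apply: hu; exists y.
    by have [_ k2] := set_valP k; rewrite (k2 _ _ _ ku kv).
  exists (setT, [set k | ~ exists y, graph k (y, x)]) => /=.
    by split; [exact: filterT|exact: imE].
  by move=> [h k] /= [_ kx] [y [/= v hv kv]]; apply: kx; exists v.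
Qed.

HB.instance Definition _ := Topological_isTopSemigroup.Build IN IN_mul_continuous.

(* [g] is the inverse of [f] on its image [range f], the latter being
   endowed with the subspace topology. *)
Definition topological_embedding (S T : topSemigroupType) (f : S -> T) : Prop :=
  [/\ injective f, {morph f : x y / x * y}, continuous f &
    exists g : set_type (range f) -> S,
      (forall y, f (g y) = set_val y) /\ continuous g].

Definition embeds_topologically (S T : topSemigroupType) : Prop :=
  exists f : S -> T, topological_embedding f.

Definition metrizable (R : realType) (T : topologicalType) : Prop :=
  exists d : T -> T -> R,
    [/\ forall x, d x x = 0%R,
        forall x y, d x y = 0%R -> x = y,
        forall x y, d x y = d y x,
        forall x y z, (d x z <= d x y + d y z)%R &
        forall A : set T, open A <->
          forall x, A x -> exists2 r : R, (0 < r)%R & [set y | (d x y < r)%R] `<=` A].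

(* For Hausdorff spaces this is stronger than the library's
   [zero_dimensional], which only separates points by clopen sets. *)
Definition clopen_based (T : topologicalType) : Prop :=
  exists2 B : set (set T), basis B & B `<=` clopen.

(* Main.v *)
Require Import Defs.
From mathcomp Require Import all_boot all_order all_algebra.
From mathcomp Require Import all_classical all_reals topology.

(** Write [E] for the semilattice of idempotents and [H_y] for the maximal
    subgroup at [y].  Both conclusions follow from the single claim that [S] has
    a countable base of clopen sets, since a Hausdorff space with such a base
    [C_0, C_1, ...] is metrized by the ultrametric [1 / (n + 1)], with [n] the
    least index such that [C_n] separates the two points
    ([metrizable_countable_clopen_base]).

    The spaces [NN] and [IN] have countable clopen subbases, and countable
    clopen bases pass to topologically embedded semigroups; hence [E] has one,
    say [C], and so does every [H_y].  Moreover every U_2-semilattice is a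
    U-semilattice, so both conditions fall under
    [countable_clopen_base_clifford].  For that result, let [s] be a point of
    [S], [x = s s^-1], and [O] a neighbourhood of [s].  Ditopologicality says
    that [t] is in [O] as soon as [t t^-1] is close enough to [x] and [y t] is
    close enough to [s] for some idempotent [y] close enough to [x].  The
    U-condition supplies such a [y] with [x] in the interior of [upper y], hence
    an index [m] with [x] in [C_m] and [C_m] contained in [upper y].  Then
    [t |-> y t] maps the clopen set of those [t] with [t t^-1] in [C_m]
    continuously into [H_y], so that for [G] in a countable clopen base of [H_y]
    the sets [{t | t t^-1 in C_m and y t in G}] are clopen
    ([translate_clopen_base]); for suitable [G] such a set lies between [s] and
    [O].

    Although [E] may be uncountable, countably many [y] are enough: all that is
    asked of [y] is that it lie in some small basic set [C_n] and that
    [C_m] be contained in [upper y], so one choice of [y] for each pair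
    [(n, m)] serves all points [s]. *)

Set Implicit Arguments.
Unset Strict Implicit.
Unset Printing Implicit Defensive.

Import Order.TTheory GRing.Theory Num.Theory.
Local Open Scope classical_set_scope.
Local Open Scope group_scope.

(** * Countable clopen bases *)

(** Enumerating by [nat], with repetitions allowed, gives the metrization below
    its weights; a finite or empty base is padded with [set0]. *)
Definition countable_clopen_base (T : topologicalType) : Prop :=
  exists C : nat -> set T,
    (forall n, clopen (C n)) /\
    (forall x A, nbhs x A -> exists n, C n x /\ C n `<=` A).

Lemma clopen_nbhs (T : topologicalType) (A : set T) x :
  clopen A -> A x -> nbhs x A.
Proof. by move=> [oA _] Ax; apply: open_nbhs_nbhs. Qed.

Lemma countable_clopen_base_countType (T : topologicalType) (I : countType)
    (C : I -> set T) :
  (forall i, clopen (C i)) ->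
  (forall x A, nbhs x A -> exists i, C i x /\ C i `<=` A) ->
  countable_clopen_base T.
Proof.
move=> clC baseC.
exists (fun n => if unpickle n is Some i then C i else set0); split.
  by move=> n; case: (unpickle n) => [i|]; [exact: clC|exact: clopen0].
move=> x A /baseC [i [Cx CA]]; exists (pickle i).
by rewrite pickleK.
Qed.

Lemma clopen_based_countable (T : topologicalType) :
  countable_clopen_base T -> clopen_based T.
Proof.
move=> [C [clC baseC]]; exists (range C); last by move=> _ [n _ <-].
split; first by move=> _ [n _ <-]; exact: (clC n).1.
move=> x A /baseC [n [Cx CA]].
by exists (C n) => //; split => //; exists n.
Qed.

(** * Metrization by the first separating index *)

Section Metrization.
Variables (R : realType) (T : topologicalType) (C : nat -> set T).
Hypothesis clC : forall n, clopen (C n).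
Hypothesis baseC : forall x A, nbhs x A -> exists n, C n x /\ C n `<=` A.
Hypothesis hT : hausdorff_space T.

Let separates (x y : T) : pred nat := fun n => `[< C n x >] != `[< C n y >].

Definition first_separation_dist (x y : T) : R :=
  if pselect (exists n, separates x y n) is left ex
  then ((ex_minn ex).+1%:R^-1)%R else 0%R.

Local Notation d := first_separation_dist.

Local Open Scope ring_scope.

Let sep_sym x y n : separates x y n = separates y x n.
Proof. by rewrite /separates eq_sym. Qed.

Let sep_trans x y z n :
  separates x z n -> separates x y n \/ separates y z n.
Proof.
rewrite /separates => xz; apply/orP; apply: contraT; rewrite negb_or !negbK.
by move=> /andP[/eqP xy /eqP yz]; move: xz; rewrite xy yz eqxx.
Qed.

Let d_ge x y n : separates x y n -> n.+1%:R^-1 <= d x y.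
Proof.
move=> sn; rewrite /d; case: pselect => [ex|nex]; last by case: nex; exists n.
case: ex_minnP => m _ /(_ _ sn) mn.
by rewrite lef_pV2 ?posrE// ler_nat.
Qed.

Let dP x y : d x y = 0 \/ exists2 n, separates x y n & d x y = n.+1%:R^-1.
Proof.
rewrite /d; case: pselect => [ex|nex]; last by left.
by right; case: ex_minnP => m sm _; exists m.
Qed.

Let d_ge0 x y : 0 <= d x y.
Proof. by have [->|[n _ ->]] := dP x y; rewrite ?invr_ge0 ?ler0n. Qed.

Let d_le_sym x y : d x y <= d y x.
Proof.
have [->|[n sn ->]] := dP x y; first exact: d_ge0.
by apply: d_ge; rewrite sep_sym.
Qed.

Let sepN x y n : ~~ separates x y n -> C n x -> C n y.
Proof.
by rewrite /separates negbK => /eqP e /asboolP; rewrite e => /asboolP.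
Qed.

Let d_eq0 x y : d x y = 0 -> x = y.
Proof.
move=> d0; apply: hT => A B Ax By.
have [n [Cx CA]] := baseC Ax; exists y; split; last exact: nbhs_singleton.
apply: CA; apply: sepN Cx; apply/negP => /d_ge.
by rewrite d0 leNgt invr_gt0 ltr0n.
Qed.

Let not_sep_nbhs x n : nbhs x [set y | ~~ separates x y n].
Proof.
have [Cx|Cx] := pselect (C n x).
  apply: filterS (clopen_nbhs (clC n) Cx) => y Cy /=.
  by rewrite /separates !asboolT.
apply: filterS (clopen_nbhs (clopenC set0 (clC n)) Cx) => y Cy /=.
by rewrite /separates !asboolF.
Qed.

Let not_sep_upto_nbhs x N :
  nbhs x [set y | forall n, (n <= N)%N -> ~~ separates x y n].
Proof.
elim: N => [|N IH].
  by apply: filterS (not_sep_nbhs x 0) => y sy [].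
apply: filterS2 IH (not_sep_nbhs x N.+1) => y sy syN n.
by rewrite leq_eqVlt => /predU1P[->//|]; exact: sy.
Qed.

(** A finite intersection of the sets [C n] or of their complements is a
    neighbourhood of each of its points, which makes balls neighbourhoods of
    their centres; conversely the ball of radius [1 / (n + 1)] around a point
    of [C n] stays inside [C n], which makes balls small.  The triangle
    inequality is the ultrametric one: an index that separates [x] from [z]
    separates [y] from one of them. *)
Lemma metrizable_of_base : metrizable R T.
Proof.
exists d; split.
- move=> x; have [//|[n]] := dP x x; by rewrite /separates eqxx.
- exact: d_eq0.
- by move=> x y; apply/le_anti; rewrite !d_le_sym.
- move=> x y z; have [->|[n /(@sep_trans _ y) sn ->]] := dP x z.
    exact: addr_ge0.
  by case: sn => /d_ge sn; rewrite (le_trans sn)// ?lerDl ?lerDr.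
move=> A; split=> [oA x Ax|oA].
  have [n [Cx CA]] := baseC (open_nbhs_nbhs (conj oA Ax)).
  exists n.+1%:R^-1; first by rewrite invr_gt0 ltr0n.
  move=> y /= dxy; apply: CA; apply: sepN Cx; apply/negP => /d_ge.
  by rewrite leNgt dxy.
rewrite openE => x /oA [r r0 rA].
have [N Nr] : exists N : nat, N.+1%:R^-1 < r.
  exists (Num.truncn r^-1); rewrite invf_plt ?posrE//.
  exact: truncnS_gt.
apply: filterS (not_sep_upto_nbhs x N) => y sy; apply: rA => /=.
have [->//|[n sn ->]] := dP x y.
apply: le_lt_trans Nr; rewrite lef_pV2 ?posrE// ler_nat ltnS.
by rewrite leqNgt; apply/negP => nN; move: sn; apply/negP/sy/ltnW.
Qed.

End Metrization.

Lemma metrizable_countable_clopen_base (R : realType) (T : topologicalType) :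
  hausdorff_space T -> countable_clopen_base T -> metrizable R T.
Proof.
by move=> hT [C [clC baseC]]; exact: metrizable_of_base clC baseC hT.
Qed.

(** * Countable clopen bases of NN and IN *)

(** The second hypothesis says that the [A i] form a subbase, phrased with
    filters because this is the form in which product and generated topologies
    give it.  It is applied to the filter generated by the finite
    intersections of the [A i] containing [x]. *)
Lemma countable_clopen_base_subbase (T : topologicalType) (I : countType)
    (A : I -> set T) :
  (forall i, clopen (A i)) ->
  (forall (F : set_system T) x, Filter F ->
     (forall i, A i x -> F (A i)) -> F --> x) ->
  countable_clopen_base T.
Proof.
move=> clA subA.
pose C (s : seq I) : set T := [set x | forall i, i \in s -> A i x].
have C0 : C [::] = setT by rewrite predeqE => x; split.
have CS i s : C (i :: s) = A i `&` C s.
  rewrite predeqE => x; split=> [Cx|[Ax Cx] j].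
    by split=> [|j js]; apply: Cx; rewrite inE ?eqxx ?js ?orbT.
  by rewrite inE => /predU1P[->|/Cx].
apply: (@countable_clopen_base_countType _ (seq I) C).
  elim=> [|i s IH]; first by rewrite C0; exact: clopenT.
  by rewrite CS; exact: clopenI.
move=> x U xU.
pose F : set_system T := filter_from [set s | C s x] C.
have FF : Filter F.
  apply: filter_from_filter; first by exists [::]; rewrite /= C0.
  move=> s t sx tx; exists (s ++ t) => /=.
    by move=> i; rewrite mem_cat => /orP[/sx|/tx].
  by move=> y Cy; split=> i si; apply: Cy; rewrite mem_cat si ?orbT.
have FA i : A i x -> F (A i).
  by move=> Ax; exists [:: i]; rewrite /= CS C0 setIT.
by have [s sx sU] := subA F x FF FA U xU; exists s.
Qed.

(** The set [f p.1 = p.2] is clopen because whether [f] belongs to it is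
    determined by the value [f p.1], which is locally constant in [f]. *)
Lemma countable_clopen_base_NN : countable_clopen_base NN.
Proof.
pose A (p : nat * nat) : set NN := [set f | f p.1 = p.2].
have openA p : open (A p).
  rewrite openE => f fp; apply: filterS (NN_eval_near f p.1) => h hp.
  by rewrite /A /= hp.
apply: (countable_clopen_base_subbase (A := A)).
  move=> p; split=> //; rewrite -openC openE => f /= fp.
  have := NN_eval_near f p.1; apply: filterS => h hp.
  by rewrite /= /A /= hp.
move=> F f FF FA; apply/cvg_sup => n B /= [_ [[D oD <-] /= Df DB]].
have := FA (n, f n) erefl; apply: filterS => h /= hn.
by apply: DB => /=; rewrite /A /= in hn; rewrite /= hn.
Qed.

(** Each set of the defining subbasis has an open complement: if [(x, y)] is
    not in [h], either [h] sends [x] elsewhere or [x] is not in the domain of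
    [h], and both are subbasic conditions; if [x] is in the domain (image) of
    [h], this is witnessed by one pair in [h]. *)
Lemma countable_clopen_base_IN : countable_clopen_base IN.
Proof.
pose A (c : nat * nat + (nat + nat)) : set IN := match c with
  | inl p => [set h | graph h p]
  | inr (inl x) => [set h | ~ exists y, graph h (x, y)]
  | inr (inr x) => [set h | ~ exists y, graph h (y, x)] end.
have sA c : IN_subbasis (A c).
  case: c => [[x y]|[x|x]]; [by left; exists x, y|right; left|right; right];
  by exists x.
have sAE B : IN_subbasis B -> exists c, B = A c.
  move=> [[x [y ->]]|[[x ->]|[x ->]]].
  - by exists (inl (x, y)).
  - by exists (inr (inl x)).
  - by exists (inr (inr x)).
have nA c h : A c h -> nbhs h (A c) by exact/IN_subbasis_nbhs.
apply: (countable_clopen_base_subbase (A := A)).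
  move=> c; split; first by rewrite openE => h; exact: nA.
  rewrite -openC openE => h; case: c => [[x y]|[x|x]].
  - move=> /= hxy; have [[z hz]|hx] := pselect (exists z, graph h (x, z)).
      apply: filterS (nA (inl (x, z)) h hz) => k /= kz ky.
      by apply: hxy; have [k1 _] := set_valP k; rewrite (k1 _ _ _ ky kz).
    apply: filterS (nA (inr (inl x)) h hx) => k /= kx ky.
    by apply: kx; exists y.
  - move=> /= /contrapT [y hy].
    by apply: filterS (nA (inl (x, y)) h hy) => k /= kx; apply; exists y.
  - move=> /= /contrapT [y hy].
    by apply: filterS (nA (inl (y, x)) h hy) => k /= kx; apply; exists y.
move=> F h FF FA U [_ [[B sB <-] [D BD Dh]] BU].
apply: (@filterS _ _ _ D) => [k Dk|]; first by apply: BU; exists D.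
have [G sG GD] := sB _ BD; move: Dh; rewrite -GD => Gh.
apply: filter_bigI => Q GQ; have := Gh _ GQ.
have := sG _ GQ; rewrite inE => /sAE [c ->]; exact: FA.
Qed.

(** * Passage to topologically embedded semigroups *)

Lemma nbhs_set_type (T : topologicalType) (A : set T) (x : set_type A)
    (U : set (set_type A)) :
  nbhs x U -> exists O : set T,
    [/\ open O, O (set_val x) & forall y : set_type A, O (set_val y) -> U y].
Proof.
by move=> [_ [[O oO <-] /= Ox OU]]; exists O; split=> // y; exact: OU.
Qed.

Lemma countable_clopen_base_embed (S T : topSemigroupType) :
  embeds_topologically S T -> countable_clopen_base T ->
  countable_clopen_base S.
Proof.
move=> [f [injf _ cf [g [fg cg]]]] [C [clC baseC]].
exists (fun n => f @^-1` C n); split.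
  by move=> n; apply: preimage_clopen.
move=> x A xA; pose r z : set_type (range f) := SigSub (mem_set (imageT f z)).
have gr z : g (r z) = z by apply: injf; rewrite fg.
have : nbhs (r x) (g @^-1` A) by apply: cg; rewrite gr.
move=> /nbhs_set_type [O [oO Ox OA]].
have [n [Cx CO]] := baseC (f x) O (open_nbhs_nbhs (conj oO Ox)).
exists n; split=> // z Cz; rewrite -(gr z); apply: OA; exact: CO.
Qed.

(** * Clifford semigroups *)

(** The open neighbourhood required by the U-condition is the complement of
    the clopen ideal. *)
Lemma U2_semilattice_U (X : semilatticeTopologyType) :
  U2_semilattice X -> U_semilattice X.
Proof.
move=> U2 U x oU Ux; have [y [I [Uy [_ cI] _ Ix Iy]]] := U2 U x oU Ux.
by exists y, (~` I); split=> //; rewrite openC.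
Qed.

Lemma mul_cvg (S : topSemigroupType) (X : Type) (F : set_system X)
    {FF : Filter F} (f g : X -> S) a b :
  f @ F --> a -> g @ F --> b -> (fun s => f s * g s) @ F --> a * b.
Proof.
move=> fa gb; apply: (@continuous2_cvg _ _ _ _ _ _ _ _ (@monoid.mul S)) => //.
exact: (@muls_continuous S (a, b)).
Qed.

Lemma mull_continuous (S : topSemigroupType) (y : S) :
  continuous (fun s : S => y * s).
Proof. by move=> s; apply: mul_cvg; [exact: cvg_cst|exact: cvg_id]. Qed.

Section Clifford.
Variable S : cliffordTopSemigroupType.
Local Notation E := (idempotent_semilattice S).

Definition unit_part (s : S) : E := SigSub (mem_set (idem_mulsV s)).

Lemma unit_part_continuous :
  continuous (@sinv S) -> continuous unit_part.
Proof.
move=> cV.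
have c : continuous (fun s : S => s * sinv s).
  by move=> s; apply: mul_cvg; [exact: cvg_id|exact: cV].
apply/continuousP => _ [B oB <-].
by move/continuousP: c => /(_ B oB).
Qed.

Lemma mulr_val_continuous (s : S) : continuous (fun e : E => set_val e * s).
Proof.
move=> e; have val_e : set_val @ nbhs e --> (set_val e : S).
  exact: (@initial_continuous _ _ set_val).
by apply: (mul_cvg val_e); exact: cvg_cst.
Qed.

(** If [y <= s s^-1] then [(y s) (y s)^-1 = y s s^-1 y = y]; commutation of
    elements with their inverses gives the other half. *)
Lemma translate_maximal_subgroup (y : E) (s : S) :
  upper y (unit_part s) -> maximal_subgroup (set_val y) (set_val y * s).
Proof.
move=> /(congr1 set_val) ys.
have {}ys : set_val y * (s * sinv s) = set_val y by exact: ys.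
have yy : set_val y * set_val y = set_val y by exact: (set_valP y).
have H : (set_val y * s) * sinv (set_val y * s) = set_val y.
  by rewrite sinvM (sinv_idem yy) !mulgA -(mulgA (set_val y)) ys.
by split=> //; rewrite -sinvC.
Qed.

(** For [K] clopen inside [upper y], the sets [D k] restrict [t t^-1] to [K] and
    [y t] to the [k]-th basic clopen set of [H_y].  They are clopen since
    [t |-> y t] is continuous from the clopen set of those [t] with [t t^-1] in
    [K] into [H_y]. *)
Lemma translate_clopen_base (y : E) (K : set E) :
  continuous (@sinv S) -> clopen K -> K `<=` upper y ->
  countable_clopen_base (maximal_subgroup_type (set_val y)) ->
  exists D : nat -> set S, (forall k, clopen (D k)) /\
    forall s U, K (unit_part s) -> nbhs (set_val y * s) U ->
      exists k, D k s /\
        forall t, D k t -> K (unit_part t) /\ U (set_val y * t).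
Proof.
move=> cV clK Ky [G [clG baseG]].
pose P := unit_part @^-1` K.
have clP : clopen P.
  by apply: preimage_clopen => //; exact: unit_part_continuous.
pose D k : set S :=
  P `&` [set t | exists2 h, G k h & set_val h = set_val y * t].
pose tr (t : S) (Pt : P t) : maximal_subgroup_type (set_val y) :=
  SigSub (mem_set (translate_maximal_subgroup (Ky _ Pt))).
have DE k t (Pt : P t) : D k t <-> G k (tr t Pt).
  split=> [[_ [h Gh ht]]|Gt]; last by split=> //; exists (tr t Pt).
  by have <- : h = tr t Pt by exact/val_inj.
exists D; split.
  move=> k; split.
    have [[O oO OG] _] := clG k.
    have -> : D k = P `&` ((fun t => set_val y * t) @^-1` O).
      rewrite predeqE => t; split=> -[Pt] => [Dt|Ot].
        split=> //; have /DE := conj Pt Dt => /(_ Pt).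
        by rewrite -OG.
      by apply/(DE _ _ Pt); rewrite -OG.
    apply: openI; first exact: clP.1.
    by move: O oO {OG}; apply/continuousP; exact: mull_continuous.
  (* [G k] is cut out of [H_y] by the complement of an open subset of [S]. *)
  have : open (~` G k) by rewrite openC; exact: (clG k).2.
  move=> [O oO OG].
  have -> : D k = P `&` ~` ((fun t => set_val y * t) @^-1` O).
    rewrite predeqE => t; split=> -[Pt] => [Dt|Ot].
      split=> // Ot; have /DE := conj Pt Dt => /(_ Pt).
      by apply: (_ : (~` G k) _); rewrite -OG.
    apply/(DE _ _ Pt); apply: contrapT => nG; apply: Ot.
    by have : (~` G k) (tr t Pt) by []; rewrite -OG.
  apply: closedI; first exact: clP.2.
  rewrite closedC.
  by move: O oO {OG}; apply/continuousP; exact: mull_continuous.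
move=> s U Ks sU; have : nbhs (tr s Ks) (set_val @^-1` U).
  exact: (@initial_continuous _ _ set_val).
move=> /baseG [k [Gs GU]]; exists k; split; first exact/(DE _ _ Ks).
by move=> t Dt; split; [exact: Dt.1|apply: (GU (tr t Dt.1)); exact/DE].
Qed.

(** The base consists of the sets of [translate_clopen_base] for [K = C m] and
    one idempotent [y] chosen for each pair [(n, m)] that admits some [y] in
    [C n] with [C m] contained in [upper y].  At a point [s], the index [n] is
    chosen by ditopologicality, so that any [y] in [C n] will do, and [m] by the
    U-condition applied to [C n]. *)
Lemma countable_clopen_base_clifford :
  ditopological S -> U_semilattice E -> countable_clopen_base E ->
  (forall e : S, idempotents S e ->
     countable_clopen_base (maximal_subgroup_type e)) ->
  countable_clopen_base S.
Proof.
move=> [cV ditop] UE [C [clC baseC]] baseH.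
pose good n m (y : E) := C n y /\ C m `<=` upper y.
have /choice [D DP] : forall p : nat * nat, exists D : nat -> set S,
    (forall k, clopen (D k)) /\
    ((exists y, good p.1 p.2 y) -> exists2 y : E, C p.1 y &
      forall s U, C p.2 (unit_part s) -> nbhs (set_val y * s) U ->
        exists k, D k s /\
          forall t, D k t -> C p.2 (unit_part t) /\ U (set_val y * t)).
  move=> [n m] /=; have [[y [Cy Cm]]|ngood] := pselect (exists y, good n m y).
    have [D [clD DP]] :=
      translate_clopen_base cV (clC m) Cm (baseH _ (set_valP y)).
    by exists D; split=> // _; exists y.
  by exists (fun=> set0); split=> // _; exact: clopen0.
apply: (@countable_clopen_base_countType _ (nat * nat * nat)%type
  (fun p => D p.1 p.2)) => [p|s O sO]; first exact: (DP p.1).1.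
have [U [W [sU sW UWO]]] := ditop s O sO.
pose x := unit_part s.
(* Asking that [U] be a neighbourhood of [e s], not just contain it, leaves
   room to move [y t] around [y s] once [y] is fixed. *)
have xW : nbhs x [set e : E | W (set_val e) /\ nbhs (set_val e * s) U].
  apply: filterI; first exact: (@initial_continuous _ _ set_val).
  have xsU : nbhs (set_val x * s) U by rewrite /= mulsVs.
  exact: (mulr_val_continuous (nbhs_interior xsU)).
have [n [Cnx CnW]] := baseC _ _ xW.
have [y [V [Cny oV Vx Vy]]] := UE _ x (clC n).1 Cnx.
(* [C m] is also taken inside [C n], so that [t t^-1] is in [W] whenever it is
   in [C m]. *)
have [m [Cmx CmV]] : exists m, C m x /\ C m `<=` V `&` C n.
  apply: baseC; apply: filterI; last exact: clopen_nbhs.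
  exact: open_nbhs_nbhs.
have [|z Cz zP] := (DP (n, m)).2.
  by exists y; split=> // z /CmV[/Vy].
have [Wz zsU] := CnW z Cz.
have [k [Dks DU]] := zP s U Cmx zsU.
exists (n, m, k); split=> // t /DU [Cmt Ut]; apply: UWO; split.
  exists (set_val z * t), (set_val z); split=> //; split=> //.
  exact: (set_valP z).
by have [] := CnW _ (CmV _ Cmt).2.
Qed.

End Clifford.

Theorem corollary2p13 (R : realType) (S : cliffordTopSemigroupType) :
  [/\ hausdorff_space S,
      ditopological S,
      U2_semilattice (idempotent_semilattice S),
      embeds_topologically (idempotent_semilattice S) NN &
      forall e : S, idempotents S e ->
        embeds_topologically (maximal_subgroup_type e) NN]
  \/
  [/\ hausdorff_space S,
      ditopological S,
      U_semilattice (idempotent_semilattice S),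
      embeds_topologically (idempotent_semilattice S) IN &
      forall e : S, idempotents S e ->
        embeds_topologically (maximal_subgroup_type e) IN] ->
  metrizable R S /\ clopen_based S.
Proof.
move=> H; suff [hS bS] : hausdorff_space S /\ countable_clopen_base S.
  split; last exact: clopen_based_countable.
  exact: metrizable_countable_clopen_base.
case: H => -[hS dS US eE eH]; split=> //.
- apply: countable_clopen_base_clifford => //.
  + exact: U2_semilattice_U.
  + exact: countable_clopen_base_embed eE countable_clopen_base_NN.
  + move=> e /eH He.
    exact: countable_clopen_base_embed He countable_clopen_base_NN.
- apply: countable_clopen_base_clifford => //.
  + exact: countable_clopen_base_embed eE countable_clopen_base_IN.
  + move=> e /eH He.
    exact: countable_clopen_base_embed He countable_clopen_base_IN.
Qed.
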